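(* Let $N$ be a real-valued random variable. Then for all $t\in\mathbb{R}$ with $t>0$, $$\sup_{a\in\mathbb{R}} P\left(-t/2<N-a\leq t/2\right)\leq \mathrm{TV}(N,N+t).$$
   Context: For random variables $X,Y$ with laws $P,Q$ on $\mathbb{R}$, $\mathrm{TV}(X,Y)=\mathrm{TV}(P,Q)=\sup_A|P(A)-Q(A)|$ (supremum over measurable sets) is the total variation distance between their distributions. *)

(* Defs.v *)
From HB Require Import structures.
From mathcomp Require Export all_boot all_order all_algebra.
From mathcomp Require Export all_classical all_reals all_analysis measurable_realfun.

Set Implicit Arguments.
Unset Strict Implicit.
Unset Printing Implicit Defensive.

Local Open Scope classical_set_scope.
Local Open Scope ereal_scope.

(* Total variation distance between two laws, with no factor 1/2 or 2.  The
   subtraction is in \bar R, but both terms are finite since mu and nu are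
   probability measures.  The library's [total_variation], about functions on
   an interval, is a different notion. *)
Definition TV_dist d (T : measurableType d) (R : realType)
    (mu nu : probability T R) : \bar R :=
  ereal_sup [set `|mu A - nu A| | A in measurable].

(* Main.v *)
Require Import Defs.
From mathcomp Require Import all_boot all_order all_algebra.
From mathcomp Require Import all_classical all_reals all_analysis measurable_realfun.
From mathcomp Require Import lra.

Import Order.TTheory GRing.Theory Num.Theory.
Import numFieldNormedType.Exports.

Local Open Scope classical_set_scope.
Local Open Scope ring_scope.

(** Shifting [N] by [t] moves the cut of the half-line from [a + t / 2] down to [a - t / 2], and the
    window is what lies between the cuts. So each probability on the left is itself one of the
    values whose supremum is [TV_dist]. *)

(* The half-line A = ]-oo, a + t/2] witnesses the bound: {N + t in A} is
   contained in {N in A}, and their difference is {-t/2 < N - a <= t/2}. *)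
Theorem lemma3 (R : realType) (d : measure_display) (T : measurableType d)
    (P : probability T R) (N : {RV P >-> R}) (t : R) (ht : 0 < t) :
  (ereal_sup [set P [set x | (- (t / 2) < N x - a <= t / 2)%R] | a in [set: R]]
     <= TV_dist (distribution P N) (distribution P (N \+ cst t)%R))%E.
Proof.
apply: ge_ereal_sup => _ [a _ <-].
set S := [set x | _].
pose A := [set` `]-oo, a + t / 2]] : set R.
have mA : measurable A by exact: measurable_itv.
apply: ereal_sup_ubound; exists A => //.
(* By conversion: a law is the pushforward of [P]. *)
rewrite -[LHS]/(`|P (N @^-1` A) - P ((N \+ cst t)%R @^-1` A)|)%E.
set B := (N \+ cst t) @^-1` A.
have SE : S = N @^-1` A `\` B.
  apply/seteqP; split=> x; rewrite /S /B /A /= !in_itv /=.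
    by move=> /andP[? ?]; split; first lra; apply/negP; lra.
  by move=> [? /negP ?]; apply/andP; split; lra.
(* Here [0 < t] enters: [N x <= a - t / 2] forces [N x <= a + t / 2]. *)
have BA : B `<=` N @^-1` A.
  by move=> x; rewrite /B /A /= !in_itv /=; lra.
have mNA : measurable (N @^-1` A) by rewrite -[X in measurable X]setTI; exact: measurable_funP.
have mB : measurable B by rewrite -[X in measurable X]setTI; exact: measurable_funP.
(* Nested events of finite measure: the difference of measures is the measure of the difference. *)
have -> : (P (N @^-1` A) - P B = P S)%E.
  rewrite SE measureD ?setIidr // -ge0_fin_numE ?measure_ge0 //.
  exact: fin_num_measure.
by rewrite gee0_abs ?measure_ge0.
Qed.
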